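(* Let $A$ and $B$ be monounary algebras. Then $A\times B$ is subalgebra separable if and only if one of the following is true: (1) $A$ and $B$ are subalgebra separable; (2) $A$ is backwards-bounded; (3) $B$ is backwards-bounded.
   Context: $\mathbb{N}$ is the set of non-negative integers. A monounary algebra $(A,f)$ is a (possibly empty) set $A$ with a function $f:A\to A$. A homomorphism $\phi:(A,f_1)\to(B,f_2)$ is a function with $\phi(f_1(a))=f_2(\phi(a))$ for all $a\in A$. A subalgebra of $(A,f)$ is a (possibly empty) subset $S\subseteq A$ with $f(S)\subseteq S$, equipped with $f|_S$; it is finitely generated if $S=\{f^n(s):n\in\mathbb{N},\,s\in G\}$ for some finite $G\subseteq A$. $A$ is strongly (respectively weakly) subalgebra separable if for any $a\in A$ and any (respectively any finitely generated) subalgebra $B\leq A$ with $a\notin B$, there exist a finite monounary algebra $F$ and a homomorphism $\phi:A\to F$ with $\phi(a)\notin\phi(B)$. For monounary algebras these two properties are equivalent, and an algebra having them is called subalgebra separable (one may take strong subalgebra separability as the definition). The direct product of $(A,f_1)$ and $(B,f_2)$ is $A\times B$ with operation $f(a,b)=(f_1(a),f_2(b))$. For $a\in A$ and $n\in\mathbb{N}$, $f^{-n}(a)=\{b\in A: f^n(b)=a\}$ (with $f^0$ the identity). $(A,f)$ is backwards-bounded if for all $a\in A$ there exists $n\in\mathbb{N}$ such that $f^{-n}(a)=\varnothing$. ''One of the following'' means at least one. *)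

(* Defs.v *)
From mathcomp Require Import all_boot.
From mathcomp Require Import boolp classical_sets cardinality.

Set Implicit Arguments.
Unset Strict Implicit.
Unset Printing Implicit Defensive.

Local Open Scope classical_set_scope.

(* The carrier is a bare [Type], so the empty algebra is included. *)
Record monounary := Monounary {
  carrier :> Type;
  unop : carrier -> carrier
}.

Definition subalgebra (A : monounary) (S : set A) : Prop :=
  @unop A @` S `<=` S.

Definition homomorphism (A B : monounary) (phi : A -> B) : Prop :=
  {morph phi : x / unop x >-> unop x}.

Definition finite_algebra (A : monounary) : Prop := finite_set [set: A].

(* This is strong subalgebra separability: [S] is not required to be
   finitely generated. *)
Definition subalgebra_separable (A : monounary) : Prop :=
  forall (a : A) (S : set A), subalgebra S -> ~ S a ->
    exists F : monounary, finite_algebra F /\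
      exists phi : A -> F, homomorphism phi /\ ~ (phi @` S) (phi a).

Definition prod_alg (A B : monounary) : monounary :=
  @Monounary (A * B)%type (fun p => (unop p.1, unop p.2)).

Definition iter_preimage (A : monounary) (n : nat) (a : A) : set A :=
  iter n (@unop A) @^-1` [set a].

Definition backwards_bounded (A : monounary) : Prop :=
  forall a : A, exists n : nat, iter_preimage n a = set0.

(* Main.v *)
Require Import Defs.
From mathcomp Require Import all_boot.
From mathcomp Require Import boolp classical_sets cardinality.

(** Separability of a monounary algebra is decided point by point: it holds iff
    every point either lies on a cycle or has some empty iterated preimage
    ([subalgebra_separableP]).

    A point [a] avoided by a subalgebra [S] is never reached from [S].  If [a]
    is cyclic, the points reaching [a] form a connected component, whose
    indicator is a homomorphism to the identity operation on [bool].  If no point reaches [a] in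
    exactly [n] steps, the set of times below [n] at which the orbit of [x]
    visits [a] is a finite homomorphic invariant of [x], which contains the time
    [0] for [x = a] and is empty on [S].  Conversely, if every iterated preimage
    of [a] is inhabited, so is every iterated preimage of its image in a finite
    algebra, and the pigeonhole principle makes that image cyclic; it then
    cannot be separated from the subalgebra of the strict iterates of [a], which
    avoids [a] unless [a] is cyclic.

    In a product, a pair is cyclic iff both coordinates are, and an iterated
    preimage of a pair is the product of those of its coordinates.  If neither
    factor is backwards-bounded, a point of one factor can be paired with a
    point of the other whose iterated preimages are all inhabited, and this
    transfers the pointwise criterion from the product to each factor. *)

Set Implicit Arguments.
Unset Strict Implicit.
Unset Printing Implicit Defensive.

Local Open Scope classical_set_scope.

Definition cyclic_point (A : monounary) (a : A) : Prop :=
  exists k, iter k.+1 (@unop A) a = a.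

Definition bounded_point (A : monounary) (a : A) : Prop :=
  exists n, iter_preimage n a = set0.

Lemma homomorphism_iter (A B : monounary) (phi : A -> B) n (x : A) :
  homomorphism phi -> phi (iter n (@unop A) x) = iter n (@unop B) (phi x).
Proof. by move=> hom; elim: n => //= n <-; rewrite hom. Qed.

Lemma subalgebra_iter (A : monounary) (S : set A) n (x : A) :
  subalgebra S -> S x -> S (iter n (@unop A) x).
Proof.
move=> subS Sx; elim: n => //= n IHn.
by apply: subS; exists (iter n (@unop A) x).
Qed.

Lemma not_bounded_pointP (A : monounary) (a : A) :
  ~ bounded_point a <-> forall n, exists x, iter n (@unop A) x = a.
Proof.
split=> [unb n | reach [n pre0]].
  have /set0P[x xa] : iter_preimage n a != set0.
    by apply/eqP => pre0; apply: unb; exists n.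
  by exists x.
by have [x xa] := reach n; have : iter_preimage n a x by []; rewrite pre0.
Qed.

(** Choosing for each [n] a point that reaches [y] in [n] steps, two choices
    must coincide; the difference of their step numbers is a period of [y]. *)
Lemma finite_cyclic_point (F : monounary) (y : F) :
  finite_algebra F -> ~ bounded_point y -> cyclic_point y.
Proof.
move=> finF /not_bounded_pointP/choice[z zy]; apply: contrapT => acyc.
have coll m n : m < n -> z m <> z n.
  move=> lt_mn eqz; apply: acyc; exists (n - m).-1.
  by rewrite prednK ?subn_gt0// -{1}(zy m) -iterD subnK 1?ltnW// eqz zy.
have injz : injective z.
  by move=> m n eqz; case: (ltngtP m n) => // /coll; rewrite eqz.
apply: infinite_nat; rewrite -(preimage_setT z).
by apply: finite_preimage => // m n _ _; apply: injz.
Qed.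

Lemma separable_cyclic_or_bounded (A : monounary) (a : A) :
  subalgebra_separable A -> cyclic_point a \/ bounded_point a.
Proof.
move=> sepA; have [|acyc] := pselect (cyclic_point a); first by left.
right; apply: contrapT => /not_bounded_pointP reach.
pose S : set A := [set x | exists k, iter k.+1 (@unop A) a = x].
have subS : subalgebra S by move=> _ [_ [k <-] <-]; exists k.+1.
have [F [finF [phi [hom sep]]]] := sepA a S subS acyc.
have [] : cyclic_point (phi a).
  apply: finite_cyclic_point => //; apply/not_bounded_pointP => n.
  have [x xa] := reach n; exists (phi x).
  by rewrite -homomorphism_iter// xa.
move=> k kphi; apply: sep; exists (iter k.+1 (@unop A) a); first by exists k.
by rewrite homomorphism_iter.
Qed.

Lemma cyclic_point_separated (A : monounary) (a : A) (S : set A) :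
  cyclic_point a -> subalgebra S -> ~ S a ->
  exists F : monounary, finite_algebra F /\
    exists phi : A -> F, homomorphism phi /\ ~ (phi @` S) (phi a).
Proof.
move=> [k ka] subS NSa; exists (@Monounary bool id); split.
  exact: finite_finset.
exists (fun x => `[< exists i, iter i (@unop A) x = a >]); split.
  move=> x; apply/asbool_equiv_eq; split=> [[i xa] | [[|i] xa]].
  - by exists i.+1; rewrite iterSr.
  (* From [a] itself, the cycle leads back to [a]. *)
  - by exists k; rewrite -iterSr (xa : x = a).
  - by exists i; rewrite -iterSr.
move=> [s Ss /esym].
have -> : `[< exists i, iter i (@unop A) a = a >] by apply/asboolP; exists 0.
by move=> /esym/asboolP[i sa]; apply: NSa; rewrite -sa; apply: subalgebra_iter.
Qed.

(** Applying the operation to [x] shifts its visiting times down by one.  Keeping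
    only the times below [n] is compatible with the shift because no orbit
    visits [a] at time [n]: the shift never has to supply the time [n - 1]. *)
Lemma bounded_point_separated (A : monounary) (a : A) (S : set A) :
  bounded_point a -> subalgebra S -> ~ S a ->
  exists F : monounary, finite_algebra F /\
    exists phi : A -> F, homomorphism phi /\ ~ (phi @` S) (phi a).
Proof.
move=> [n pre0] subS NSa.
have no_visit x : iter n (@unop A) x <> a.
  by move=> xa; have : iter_preimage n a x by []; rewrite pre0.
have n_gt0 : 0 < n by case: n no_visit {pre0} => // /(_ a).
pose shift (T : {set 'I_n}) := [set i : 'I_n | [exists j in T, j == i.+1 :> nat]]%SET.
pose visits x := [set i : 'I_n | `[< iter i (@unop A) x = a >]]%SET.
exists (@Monounary {set 'I_n} shift); split; first exact: finite_finset.
exists visits; split.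
  move=> x; apply/setP => i; rewrite !inE -iterSr.
  apply/asboolP/exists_inP => [xa | [j + /eqP <-]]; last by rewrite inE => /asboolP.
  have lt_in : i.+1 < n.
    rewrite ltn_neqAle ltn_ord andbT; apply/eqP => eq_in.
    by apply: (no_visit x); rewrite -eq_in.
  by exists (Ordinal lt_in); rewrite // inE; apply/asboolP.
move=> [s Ss /setP/(_ (Ordinal n_gt0))]; rewrite !inE /=.
by rewrite [RHS]asboolT// => /asboolP sa; apply: NSa; rewrite -sa.
Qed.

Lemma subalgebra_separableP (A : monounary) :
  subalgebra_separable A <-> forall a : A, cyclic_point a \/ bounded_point a.
Proof.
split=> [sepA a | ptA a S]; first exact: separable_cyclic_or_bounded.
have [] := ptA a; first exact: cyclic_point_separated.
exact: bounded_point_separated.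
Qed.

Lemma iter_prod (A B : monounary) n (p : prod_alg A B) :
  iter n (@unop (prod_alg A B)) p = (iter n (@unop A) p.1, iter n (@unop B) p.2).
Proof. by elim: n => [|n /= ->] //; case: p. Qed.

(** The product of periods of the coordinates is a period of the pair. *)
Lemma cyclic_point_prod (A B : monounary) (a : A) (b : B) :
  cyclic_point ((a, b) : prod_alg A B) <-> cyclic_point a /\ cyclic_point b.
Proof.
split=> [[k] | [[k ka] [l lb]]].
  by rewrite iter_prod => -[ka kb]; split; exists k.
exists (k.+1 * l.+1).-1; rewrite prednK ?muln_gt0// iter_prod; congr pair.
  by rewrite mulnC iterM; apply: iter_fix.
by rewrite iterM; apply: iter_fix.
Qed.

Lemma bounded_point_prod (A B : monounary) (a : A) (b : B) :
  bounded_point ((a, b) : prod_alg A B) <-> bounded_point a \/ bounded_point b.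
Proof.
have preE n : iter_preimage n ((a, b) : prod_alg A B) =
    iter_preimage n a `*` iter_preimage n b.
  by apply/seteqP; split=> p; rewrite /iter_preimage /= iter_prod => -[-> ->].
split=> [|[] [n pre0]]; last 2 first.
- by exists n; rewrite preE pre0 set0X.
- by exists n; rewrite preE pre0 setX0.
move=> [n pre0]; apply: contrapT => /not_orP[].
move=> /not_bounded_pointP/(_ n)[x xa] /not_bounded_pointP/(_ n)[y yb].
have : iter_preimage n ((a, b) : prod_alg A B) (x, y) by rewrite preE.
by rewrite pre0.
Qed.

Theorem theorem6p10 (A B : monounary) :
  subalgebra_separable (prod_alg A B) <->
  (subalgebra_separable A /\ subalgebra_separable B) \/
  backwards_bounded A \/
  backwards_bounded B.
Proof.
rewrite !subalgebra_separableP; split=> [ptAB | ].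
  have [|/existsNP[a0 unb_a0]] := pselect (backwards_bounded A); first by right; left.
  have [|/existsNP[b0 unb_b0]] := pselect (backwards_bounded B); first by right; right.
  left; split=> [a | b].
    by have [/cyclic_point_prod[]|/bounded_point_prod[]] := ptAB (a, b0); [left | right |].
  by have [/cyclic_point_prod[]|/bounded_point_prod[]] := ptAB (a0, b); [left | | right].
move=> [[ptA ptB] | [bA | bB]] [a b].
- have [ca | ba] := ptA a; last by right; apply/bounded_point_prod; left.
  have [cb | bb] := ptB b; last by right; apply/bounded_point_prod; right.
  by left; apply/cyclic_point_prod.
- by right; apply/bounded_point_prod; left; apply: bA.
- by right; apply/bounded_point_prod; right; apply: bB.
Qed.
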